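(* Let $V$ be a finite set, let $t\ge 1$ be an integer, let $T\subseteq V$ with $|T|=t-1$, and let $y\in\mathbb{R}^{\mathcal{P}_{t+1}(V)}$. The matrix $M(T;y)$ is positive semidefinite if and only if for all subsets $S$ of $T$ the matrix $$A(S,T)(y):=\sum_{S':\,S\subseteq S'\subseteq T}(-1)^{|S'\setminus S|}A_{S'}(y)$$ is positive semidefinite.
   Context: For a finite set $V$ and an integer $r\ge0$, $\mathcal{P}_r(V)$ is the collection of subsets of $V$ of cardinality at most $r$. The empty set is denoted $\mathbf 0$, and $\{i\}$ is identified with $i$. For $S\subseteq V$ let $\mathcal{A}_S:=\{S\}\cup\{S\cup\{i\}\mid i\in V\}$, regarded as a multiset with $|V|+1$ members (repetitions such as $S$ and $S\cup\{i\}$ for $i\in S$ are kept). For $T\subseteq V$ let $\mathcal{A}(T):=\bigcup_{S\subseteq T}\mathcal{A}_S$, again regarded as a multiset with all repetitions kept, so that it has $2^{|T|}(|V|+1)$ members. For $|T|=t-1$ and $y\in\mathbb{R}^{\mathcal{P}_{t+1}(V)}$, $M(T;y)$ is the matrix with rows and columns indexed by $\mathcal{A}(T)$ whose $(I,J)$-entry is $y_{I\cup J}$. For $S\subseteq T$, $A_S(y)$ is the principal submatrix of $M(T;y)$ indexed by $\mathcal{A}_S$; viewed as a matrix with rows and columns indexed by $\mathcal{P}_1(V)$, its entries are $A_S(y)_{\mathbf 0,\mathbf 0}=y_S$, $A_S(y)_{\mathbf 0,i}=A_S(y)_{i,\mathbf 0}=y_{S\cup\{i\}}$, $A_S(y)_{i,j}=y_{S\cup\{i,j\}}$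 for $i,j\in V$. *)

(* Defs.v *)
From mathcomp Require Import all_boot all_order all_algebra.
From mathcomp Require Export reals.

Set Implicit Arguments.
Unset Strict Implicit.
Unset Printing Implicit Defensive.

Import Order.TTheory GRing.Theory Num.Theory.
Local Open Scope ring_scope.

Definition psdmx (R : realType) (n : nat) (A : 'M[R]_n) : Prop :=
  A^T = A /\ forall x : 'cV[R]_n, 0 <= (x^T *m A *m x) 0 0.

Notation "''P_' r ( V )" := {I : {set V} | (#|I| <= r)%N}
  (at level 8, r at level 2, format "''P_' r ( V )") : type_scope.

(* y_I.  The value 0 for #|I| > r only makes the function total: all entries of
   the matrices below that are used lie within range (see card_Amulti). *)
Definition ycoord (R : realType) (V : finType) (r : nat)
    (y : {ffun 'P_r(V) -> R}) (I : {set V}) : R :=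
  if insub I is Some u then y u else 0.

(* The multiset A(T) is the family of sets S :|: I indexed by the pairs (S, I)
   with S \subset T and I in P_1(V); distinct indices with the same set are the
   repeated members.  The members with first component S form A_S. *)
Definition Aindex (V : finType) (T : {set V}) : finType :=
  ({S : {set V} | S \subset T} * 'P_1(V))%type.

Definition Amulti (V : finType) (T : {set V}) (a : Aindex T) : {set V} :=
  val a.1 :|: val a.2.

Definition Mmx (R : realType) (V : finType) (r : nat) (T : {set V})
    (y : {ffun 'P_r(V) -> R}) : 'M[R]_#|Aindex T| :=
  \matrix_(a, b)
    ycoord y (Amulti (enum_val a) :|: Amulti (enum_val b)).

Definition Amx (R : realType) (V : finType) (r : nat) (S : {set V})
    (y : {ffun 'P_r(V) -> R}) : 'M[R]_#|{: 'P_1(V)}| :=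
  \matrix_(a, b) ycoord y (S :|: val (enum_val a) :|: val (enum_val b)).

Definition Adiff (R : realType) (V : finType) (r : nat) (S T : {set V})
    (y : {ffun 'P_r(V) -> R}) : 'M[R]_#|{: 'P_1(V)}| :=
  \sum_(S' : {set V} | (S \subset S') && (S' \subset T))
    (-1) ^+ #|S' :\: S| *: Amx S' y.

Lemma card_P1 (V : finType) : #|{: 'P_1(V)}| = #|V|.+1.
Proof.
pose f (o : option V) : {set V} := if o is Some i then [set i] else set0.
have f1 o : (#|f o| <= 1)%N by case: o => [i|]; rewrite ?cards1 ?cards0.
pose g o : 'P_1(V) := exist _ (f o) (f1 o).
have ginj : injective g.
  move=> [i|] [j|] // /(congr1 val) /=.
  - by move/set1P: (set11 i) => _ /set1_inj ->.
  - by move/setP/(_ i); rewrite !inE eqxx.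
  - by move/setP/(_ j); rewrite !inE eqxx.
rewrite -card_option -(card_imset _ ginj) -cardsT; apply: eq_card => u.
rewrite !inE; apply/esym/imsetP.
have := valP u; rewrite leq_eqVlt ltnS leqn0 cards_eq0.
case/orP => [/cards1P [i Ei]|/eqP E0].
- by exists (Some i) => //; apply: val_inj.
- by exists None => //; apply: val_inj.
Qed.

Lemma card_Aindex (V : finType) (T : {set V}) :
  #|Aindex T| = (2 ^ #|T| * #|V|.+1)%N.
Proof.
rewrite card_prod card_P1 card_sig -card_powerset.
by congr (_ * _)%N; apply: eq_card => S; rewrite !inE.
Qed.

Lemma card_Amulti (V : finType) (t : nat) (T : {set V}) (a b : Aindex T) :
  (0 < t)%N -> #|T| = (t - 1)%N -> (#|Amulti a :|: Amulti b| <= t.+1)%N.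
Proof.
move=> t0 hT; have sub : Amulti a :|: Amulti b \subset T :|: (val a.2 :|: val b.2).
  rewrite /Amulti setUACA setSU // subUset.
  by rewrite (valP a.1) (valP b.1).
apply: leq_trans (subset_leq_card sub) _.
apply: leq_trans (leq_card_setU _ _) _.
have -> : (t.+1 = #|T| + (1 + 1))%N by rewrite hT addnA !addn1 subn1 prednK.
rewrite leq_add2l; apply: leq_trans (leq_card_setU _ _) _.
exact: leq_add (valP a.2) (valP b.2).
Qed.

Lemma ycoordE (R : realType) (V : finType) (r : nat)
    (y : {ffun 'P_r(V) -> R}) (I : {set V}) (hI : (#|I| <= r)%N) :
  ycoord y I = y (exist _ I hI).
Proof. by rewrite /ycoord insubT. Qed.

Lemma Amx_principal (R : realType) (V : finType) (r : nat) (S T : {set V})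
    (hS : S \subset T) (y : {ffun 'P_r(V) -> R}) :
  let f (a : 'I_#|{: 'P_1(V)}|) : 'I_#|Aindex T| :=
    enum_rank ((exist _ S hS, enum_val a) : Aindex T) in
  Amx S y = mxsub f f (Mmx T y).
Proof.
move=> f; apply/matrixP => a b; rewrite !mxE !enum_rankK /Amulti /=.
by rewrite setUACA setUid setUA.
Qed.

(* Main.v *)
Require Import Defs.
From mathcomp Require Import all_boot all_order all_algebra.
Import GRing.Theory Num.Theory.
Local Open Scope ring_scope.

(** The statement is Moebius inversion on the Boolean lattice of subsets of [T],
    carried out by congruences of matrices.

    The matrix [Mmx T y] consists of blocks indexed by pairs [(S, S')] of subsets
    of [T], and the block at [(S, S')] is [Amx (S :|: S') y]: it depends only on
    the join.  Since [Adiff] is the Moebius transform of [Amx], each [Amx U y] is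
    the sum of the [Adiff W T y] over the [W] above [U] ([Amx_sum_Adiff]), and
    [W] is above [S :|: S'] exactly when it is above both [S] and [S'].  Hence
    the quadratic form of [Mmx T y] at a block vector [(z_S)] is the sum over [W]
    of the form of [Adiff W T y] at [w_W], the sum of the [z_S] with
    [S \subset W] ([Mmx_congruence]).  If all the [Adiff W T y] are positive
    semidefinite, so is [Mmx T y].

    Conversely the change of variables from [(z_S)] to [(w_W)] is invertible,
    again by Moebius inversion: every vector [x] arises as [w_S] while all the
    other [w_W] vanish ([cumul_mobius]).  So [Adiff S T y] is itself a congruence
    transform of [Mmx T y] ([Adiff_congruence]) and inherits its
    positivity. *)

(** When some [i] lies in [W] but not in [S], adding [i] to a set matches the
    members of the interval without [i] with those containing [i], and
    reverses the sign. *)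
Lemma sum_sign_interval (R : pzRingType) (V : finType) (S W : {set V}) :
  \sum_(U : {set V} | (S \subset U) && (U \subset W)) (-1) ^+ #|U :\: S|
    = (S == W)%:R :> R.
Proof.
have [WS|/subsetPn [i iW iS]] := boolP (W \subset S).
  have [<-|neSW] := eqVneq S W.
    rewrite (big_pred1 S) => [|U]; first by rewrite setDv cards0.
    by rewrite -eqEsubset eq_sym.
  rewrite big_pred0 // => U; apply/negP => /andP[SU UW].
  by move: neSW; rewrite eqEsubset (subset_trans SU UW) WS.
have -> : (S == W) = false by apply: contraNF iS => /eqP ->.
rewrite (bigID (fun U : {set V} => i \in U)) /=.
rewrite (reindex_onto (fun U => i |: U) (fun U => U :\ i)) /=; last first.
  by move=> U /andP[_ iU]; rewrite setD1K.
rewrite (eq_bigl (fun U : {set V} =>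
    (S \subset U) && (U \subset W) && (i \notin U))); last first.
  move=> U /=; rewrite setU11 andbT subUset sub1set iW /=.
  have [iU|iU] := boolP (i \in U).
    rewrite andbF; apply/negP => /andP[_ /eqP/setP/(_ i)].
    by rewrite !inE eqxx iU.
  rewrite setU1K // eqxx !andbT; congr (_ && _).
  apply/idP/idP => [/subsetP SU|SU]; last exact: subset_trans SU (subsetUr _ _).
  apply/subsetP => j jS.
  have /setU1P[ji|//] := SU j jS.
  by rewrite -ji jS in iS.
rewrite -big_split big1 // => U /andP[_ iU] /=.
by rewrite setDUl (setDidPl _) ?disjoints1 // cardsU1 inE (negPf iU) andbF
  exprS mulN1r addNr.
Qed.

(** The dual form, with the sign measured from the top of the interval: the two
    signs differ by the factor [(-1) ^+ #|W :\: S|], which is constant on the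
    interval. *)
Lemma sum_cosign_interval (R : pzRingType) (V : finType) (S W : {set V}) :
  \sum_(U : {set V} | (S \subset U) && (U \subset W)) (-1) ^+ #|W :\: U|
    = (S == W)%:R :> R.
Proof.
transitivity ((-1) ^+ #|W :\: S| * (S == W)%:R : R); last first.
  by case: eqP => [->|_]; rewrite ?mulr0 // setDv cards0 mulr1.
rewrite -sum_sign_interval mulr_sumr; apply: eq_bigr => U /andP[SU UW].
have -> : #|W :\: S| = (#|W :\: U| + #|U :\: S|)%N.
  rewrite -(cardsID U (W :\: S)) addnC; congr (_ + _)%N; apply: eq_card => j.
    rewrite !inE; case: (boolP (j \in U)) => //= jU.
    by rewrite (contraNN (subsetP SU j) jU).
  rewrite !inE; case: (boolP (j \in U)) => [jU|_]; last by rewrite !andbF.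
  by rewrite (subsetP UW _ jU) !andbT.
by rewrite exprD -mulrA -expr2 sqrr_sign mulr1.
Qed.

(** Moebius inversion: after exchanging the sums, the coefficient of [Amx S' y]
    is the alternating sum over the interval from [U] to [S']. *)
Lemma Amx_sum_Adiff (R : realType) (V : finType) (r : nat) (U T : {set V})
    (y : {ffun 'P_r(V) -> R}) : U \subset T ->
  Amx U y = \sum_(W : {set V} | (U \subset W) && (W \subset T)) Adiff W T y.
Proof.
move=> UT; rewrite /Adiff.
rewrite (exchange_big_dep (fun S' : {set V} => S' \subset T)) /=; last first.
  by move=> W S' _ /andP[].
transitivity (\sum_(S' : {set V} | S' \subset T) (U == S')%:R *: Amx S' y).
  rewrite (bigD1 U) //= eqxx scale1r big1 ?addr0 // => S' /andP[_ /negPf neU].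
  by rewrite eq_sym neU scale0r.
apply: eq_bigr => S' S'T; rewrite -sum_cosign_interval scaler_suml.
apply: eq_bigl => W; rewrite S'T andbT.
have [WS'|_] := boolP (W \subset S'); last by rewrite !andbF.
by rewrite (subset_trans WS' S'T) !andbT.
Qed.

(** Sends the block vector [(z_S)] to the sum of the [z_S] with
    [S \subset W]. *)
Definition cumul (R : realType) (V : finType) (T W : {set V}) :
    'M[R]_(#|{: 'P_1(V)}|, #|Aindex T|) :=
  \matrix_(i, a)
    ((val (enum_val a : Aindex T).1 \subset W)
      && (enum_val i == (enum_val a : Aindex T).2))%:R.

(** Sends [x] to the block vector [(z_U)] with [z_U] equal to [x] times the
    value at [(S, U)] of the Moebius function of the Boolean lattice. *)
Definition mobius (R : realType) (V : finType) (T S : {set V}) :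
    'M[R]_(#|Aindex T|, #|{: 'P_1(V)}|) :=
  \matrix_(a, i)
    (((S \subset val (enum_val a : Aindex T).1)
        && (enum_val i == (enum_val a : Aindex T).2))%:R
      * (-1) ^+ #|val (enum_val a : Aindex T).1 :\: S|).

(** The block of the product is the identity times the sum over [U] between [S]
    and [W] of the Moebius values at [(S, U)]. *)
Lemma cumul_mobius (R : realType) (V : finType) (S T W : {set V}) :
  W \subset T -> cumul R V T W *m mobius R V T S = (S == W)%:R%:M.
Proof.
move=> WT; apply/matrixP => i j; rewrite !mxE.
pose F (a : Aindex T) : R :=
  ((val a.1 \subset W) && (enum_val i == a.2))%:R *
  (((S \subset val a.1) && (enum_val j == a.2))%:R
    * (-1) ^+ #|val a.1 :\: S|).
under eq_bigr => a _ do rewrite !mxE -/(F (enum_val a)).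
rewrite -(big_enum_val F) /= -(pair_bigA _ (fun U I => F (U, I))) /=.
pose G (U : {set V}) : R := ((S \subset U) && (U \subset W))%:R
    * (-1) ^+ #|U :\: S| * (i == j)%:R.
rewrite (eq_bigr (fun U : {U : {set V} | U \subset T} => G (val U))).
  rewrite -(big_sub (fun U : {set V} => U \subset T) G) /G -mulr_suml.
  rewrite -[RHS]mulr_natr -sum_sign_interval; congr (_ * _).
  rewrite [RHS]big_mkcond [LHS]big_mkcond /=; apply: eq_bigr => U _.
  rewrite unfold_in; case: ifPn => UT.
    by case: ifP => _; rewrite (mul1r, mul0r).
  by case: ifP => // /andP[_ UW]; rewrite (subset_trans UW WT) in UT.
move=> U _; rewrite (bigD1 (enum_val i)) //= big1 => [|I neI].
  rewrite addr0 /F /G /= eqxx andbT (inj_eq enum_val_inj) [j == i]eq_sym.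
  by do 2!case: (_ \subset _); case: (i == j);
    rewrite ?mul0r ?mulr0 ?mul1r ?mulr1.
by rewrite /F /= eq_sym (negPf neI) andbF mul0r.
Qed.

(** The block of [Mmx T y] at [(S, S')] is [Amx (S :|: S') y], whose Moebius
    expansion runs over the [W] containing both [S] and [S']; these are the [W]
    for which the two outer factors are nonzero on the blocks [S] and [S']. *)
Lemma Mmx_congruence (R : realType) (V : finType) (r : nat) (T : {set V})
    (y : {ffun 'P_r(V) -> R}) :
  Mmx T y = \sum_(W : {set V} | W \subset T)
    (cumul R V T W)^T *m Adiff W T y *m cumul R V T W.
Proof.
apply/matrixP => a b; set Sa := val (enum_val a).1; set Sb := val (enum_val b).1.
pose ia := enum_rank (enum_val a).2; pose ib := enum_rank (enum_val b).2.
have -> : Mmx T y a b = Amx (Sa :|: Sb) y ia ib.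
  by rewrite !mxE !enum_rankK /Amulti setUACA setUA.
have sT : Sa :|: Sb \subset T.
  by rewrite subUset (valP (enum_val a).1) (valP (enum_val b).1).
rewrite (Amx_sum_Adiff _ _ _ _ _ _ sT) !summxE big_mkcond [RHS]big_mkcond /=.
apply: eq_bigr => W _; case: (boolP (W \subset T)) => WT; rewrite ?andbF // andbT.
have cE (c : 'I_#|Aindex T|) i : cumul R V T W i c
    = ((val (enum_val c).1 \subset W) && (i == enum_rank (enum_val c).2))%:R.
  by rewrite mxE -(inj_eq enum_val_inj i) enum_rankK.
rewrite mxE (bigD1 ib) //= big1 ?addr0 => [|j /negPf nej]; last first.
  by rewrite cE nej andbF mulr0.
rewrite mxE (bigD1 ia) //= big1 ?addr0 => [|i /negPf nei]; last first.
  by rewrite mxE cE nei andbF mul0r.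
rewrite mxE !cE !eqxx !andbT -/Sa -/Sb subUset.
by do 2!case: (_ \subset _); rewrite ?mul0r ?mulr0 ?mul1r ?mulr1.
Qed.

(** In the expansion of [Mmx T y], the transform by [mobius R V T S] leaves only
    the term [W = S]. *)
Lemma Adiff_congruence (R : realType) (V : finType) (r : nat) (S T : {set V})
    (y : {ffun 'P_r(V) -> R}) : S \subset T ->
  Adiff S T y = (mobius R V T S)^T *m Mmx T y *m mobius R V T S.
Proof.
move=> ST; rewrite Mmx_congruence mulmx_sumr mulmx_suml (bigD1 S) //=.
have congr_mobius (W : {set V}) : W \subset T -> (mobius R V T S)^T *m
      ((cumul R V T W)^T *m Adiff W T y *m cumul R V T W) *m mobius R V T S
    = (S == W)%:R%:M *m Adiff W T y *m (S == W)%:R%:M.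
  move=> WT; rewrite !mulmxA -trmx_mul -(mulmxA _ (cumul R V T W)).
  by rewrite cumul_mobius // tr_scalar_mx.
rewrite congr_mobius // eqxx mul1mx mulmx1 big1 ?addr0 // => W /andP[WT neW].
by rewrite congr_mobius // eq_sym (negPf neW) -scalemx1 scale0r !mul0mx.
Qed.

Lemma psdmx_congr (R : realType) (m n : nat) (A : 'M[R]_m) (C : 'M[R]_(m, n)) :
  psdmx A -> psdmx (C^T *m A *m C).
Proof.
move=> [symA psdA]; split; first by rewrite !trmx_mul trmxK symA mulmxA.
by move=> x; have := psdA (C *m x); rewrite trmx_mul !mulmxA.
Qed.

Lemma psdmx_sum (R : realType) (n : nat) (I : finType) (P : pred I)
    (A : I -> 'M[R]_n) :
  (forall i, P i -> psdmx (A i)) -> psdmx (\sum_(i | P i) A i).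
Proof.
move=> psdA; split=> [|x].
  by rewrite linear_sum; apply: eq_bigr => i /psdA[].
rewrite mulmx_sumr mulmx_suml summxE; apply: sumr_ge0 => i /psdA[_].
exact.
Qed.

Theorem lemma2p2 (R : realType) (V : finType) (t : nat) (ht : (1 <= t)%N)
    (T : {set V}) (hT : #|T| = (t - 1)%N) (y : {ffun 'P_t.+1(V) -> R}) :
  psdmx (Mmx T y) <->
  forall S : {set V}, S \subset T -> psdmx (Adiff S T y).
Proof.
split=> [psdM S ST|psdA].
  by rewrite Adiff_congruence //; apply: psdmx_congr.
rewrite Mmx_congruence; apply: psdmx_sum => W WT.
exact/psdmx_congr/psdA.
Qed.
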